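(* Let $\Omega\subset\mathbb{R}^d$, let $K:\Omega\times\Omega\to\mathbb{R}$ be a strictly positive definite kernel, let $X=\{x_1,\ldots,x_N\}\subset\Omega$ be a set of $N$ distinct points, and assume that the kernel interpolant $P_g$ on $X$ of the constant function $g\equiv1$ does not vanish at any point of $\Omega$. Let $\{u_j\}_{j=1}^N$ be the cardinal basis of $\mathrm{span}\{K(\cdot,x): x\in X\}$. Then the rescaled interpolation method $f\mapsto \hat P_f=P_f/P_g$ is a Shepard's method with weight functions $$\hat u_j=\frac{u_j}{\sum_{k=1}^N u_k},\qquad j=1,\ldots,N.$$ That is, $\sum_{k=1}^N u_k(x)\neq 0$ for all $x\in\Omega$, $\sum_{j=1}^N\hat u_j(x)=1$ for all $x\in\Omega$, and for every $f:\Omega\to\mathbb{R}$, $$\hat P_f(x)=\sum_{j=1}^N f(x_j)\,\hat u_j(x)\qquad\text{for all }x\in\Omega.$$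
   Context: A kernel $K:\Omega\times\Omega\to\mathbb{R}$ is strictly positive definite if it is symmetric and, for every finite set of distinct points of $\Omega$, the matrix of values of $K$ on pairs of these points is positive definite. For a function $f:\Omega\to\mathbb{R}$ and a set $X=\{x_1,\ldots,x_N\}\subset\Omega$ of distinct points, the kernel interpolant of $f$ on $X$ is $$P_f(x)=\sum_{i=1}^N c_i K(x,x_i),\qquad x\in\Omega,$$ where $c=(c_1,\ldots,c_N)^T$ is the unique solution of the linear system $Ac=(f(x_1),\ldots,f(x_N))^T$ with $A_{i,j}=K(x_i,x_j)$. Let $g:\Omega\to\mathbb{R}$, $g\equiv1$. The rescaled interpolant of $f$ on $X$ is $\hat P_f(x)=P_f(x)/P_g(x)$, $x\in\Omega$, which is defined when $P_g$ does not vanish on $\Omega$. The cardinal basis of $\mathrm{span}\{K(\cdot,x): x\in X\}$ is the unique set of functions $u_1,\ldots,u_N$ in this space with $u_j(x_i)=\delta_{ij}$ for $1\le i,j\le N$. A Shepard's method on $X$ with weight functions $w_1,\ldots,w_N:\Omega\to\mathbb{R}$ is the approximation scheme $f\mapsto\sum_{j=1}^N f(x_j)w_j$, where the weights form a partition of unity, in the sense that $\sum_{j=1}^N w_j(x)=1$ for all $x\in\Omega$ (nonnegativity of the weights is not required). *)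

(* Defs.v *)
From HB Require Import structures.
From mathcomp Require Import all_boot all_order all_algebra.
From mathcomp Require Import all_classical all_reals.

Set Implicit Arguments.
Unset Strict Implicit.
Unset Printing Implicit Defensive.
Import Order.TTheory GRing.Theory Num.Theory.
Local Open Scope classical_set_scope.
Local Open Scope ring_scope.

Section RescaledInterpolation.
(* T is the domain of the kernel; for a set Omega it is the type of its points,
   so that functions and kernels are defined on Omega only. *)
Context {R : realType} {T : Type}.

Definition posdefmx n (A : 'M[R]_n) : Prop :=
  A^T = A /\ forall v : 'cV[R]_n, v != 0 -> 0 < (v^T *m A *m v) 0 0.

Definition kernel_matrix n (K : T -> T -> R) (x : 'I_n -> T) : 'M[R]_n :=
  \matrix_(i, j) K (x i) (x j).

Definition strictly_posdef (K : T -> T -> R) : Prop :=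
  (forall y z, K y z = K z y) /\
  (forall n (x : 'I_n -> T), injective x -> posdefmx (kernel_matrix K x)).

Definition kernel_comb n (K : T -> T -> R) (x : 'I_n -> T) (c : 'cV[R]_n)
  : T -> R := fun y => \sum_(i < n) c i 0 * K y (x i).

Definition kernel_span n (K : T -> T -> R) (x : 'I_n -> T) : set (T -> R) :=
  range (kernel_comb K x).

(* [xget] picks the solution of the linear system, which is unique when K is
   strictly positive definite and x is injective; the default 0 is only used
   when there is no solution. *)
Definition interp_coef n (K : T -> T -> R) (x : 'I_n -> T) (f : T -> R)
  : 'cV[R]_n :=
  xget 0 [set c : 'cV[R]_n | kernel_matrix K x *m c = \col_i f (x i)].

Definition interpolant n (K : T -> T -> R) (x : 'I_n -> T) (f : T -> R)
  : T -> R := kernel_comb K x (interp_coef K x f).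

(* Meaningful only where the interpolant of the constant 1 does not vanish. *)
Definition rescaled_interpolant n (K : T -> T -> R) (x : 'I_n -> T)
  (f : T -> R) : T -> R :=
  fun y => interpolant K x f y / interpolant K x (fun=> 1) y.

Definition cardinal_basis n (K : T -> T -> R) (x : 'I_n -> T)
  (u : 'I_n -> T -> R) : Prop :=
  (forall j, kernel_span K x (u j)) /\
  (forall i j, u j (x i) = (i == j)%:R).

(* The weights are not required to be nonnegative. *)
Definition shepard_method n (x : 'I_n -> T) (w : 'I_n -> T -> R)
  (S : (T -> R) -> T -> R) : Prop :=
  (forall y, \sum_(j < n) w j y = 1) /\
  (forall f y, S f y = \sum_(j < n) f (x j) * w j y).

End RescaledInterpolation.

(* Main.v *)
(* With A the kernel matrix and A c_j = e_j the coefficients of u_j, uniqueness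
   of the solution of A c = (f(x_i))_i gives c = \sum_j f(x_j) c_j, that is,
   P_f = \sum_j f(x_j) u_j.  For f = 1 this reads P_g = \sum_j u_j. *)
Require Import Defs.
From HB Require Import structures.
From mathcomp Require Import all_boot all_order all_algebra.
From mathcomp Require Import all_classical all_reals.
Import Order.TTheory GRing.Theory Num.Theory.
Local Open Scope classical_set_scope.
Local Open Scope ring_scope.

(** If [A *m v = A *m w] with [v != w], the quadratic form of [A] vanishes at the nonzero vector
    [v - w], against positivity. *)
Lemma posdefmx_mulmx_inj (R : realType) n (A : 'M[R]_n) :
  posdefmx A -> injective (fun v : 'cV_n => A *m v).
Proof.
move=> [_ Apos] v w Avw; apply/eqP; rewrite -subr_eq0.
apply: contraT => /Apos.
by rewrite -mulmxA mulmxBr Avw subrr mulmx0 mxE ltxx.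
Qed.

Section Kernel.
Context {R : realType} {T : Type} {n : nat}.
Variables (K : T -> T -> R) (x : 'I_n -> T).

(** Translates the linear system for the coefficients into interpolation conditions at the nodes. *)
Lemma kernel_matrix_mul (c : 'cV_n) :
  kernel_matrix K x *m c = \col_i kernel_comb K x c (x i).
Proof.
apply/colP => i; rewrite !mxE.
by apply: eq_bigr => j _; rewrite mxE mulrC.
Qed.

Lemma kernel_comb_sum (a : 'I_n -> R) (c : 'I_n -> 'cV_n) y :
  kernel_comb K x (\sum_j a j *: c j) y = \sum_j a j * kernel_comb K x (c j) y.
Proof.
under [RHS]eq_bigr do rewrite mulr_sumr.
rewrite exchange_big; apply: eq_bigr => i _.
rewrite summxE mulr_suml; apply: eq_bigr => j _.
by rewrite mxE mulrA.
Qed.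

Hypotheses (Kpos : strictly_posdef K) (xinj : injective x).

(** Removes the choice made by [xget]: matching [f] at the nodes is enough to identify the
    interpolant. *)
Lemma interpolant_unique (f : T -> R) (c : 'cV_n) :
  (forall i, kernel_comb K x c (x i) = f (x i)) ->
  interpolant K x f = kernel_comb K x c.
Proof.
move=> cf; rewrite /interpolant /interp_coef; congr kernel_comb.
have Ac : kernel_matrix K x *m c = \col_i f (x i).
  by rewrite kernel_matrix_mul; apply/colP => i; rewrite !mxE cf.
(* Since [c] solves the system, the default 0 is not a fallback here; it remains to see that any
   other solution [c'] equals [c]. *)
apply: xget_unique => //= c' Ac'.
by apply: (posdefmx_mulmx_inj _ _ _ (Kpos.2 _ _ xinj)); rewrite Ac Ac'.
Qed.

Lemma interpolant_cardinal (u : 'I_n -> T -> R) (f : T -> R) y :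
  cardinal_basis K x u -> interpolant K x f y = \sum_j f (x j) * u j y.
Proof.
move=> [uspan ux].
(* Fix one coefficient vector for each cardinal function. *)
have /choice[c uE] : forall j, exists c, kernel_comb K x c = u j.
  by move=> j; have [c _ <-] := uspan j; exists c.
rewrite (@interpolant_unique f (\sum_j f (x j) *: c j)).
  by rewrite kernel_comb_sum; apply: eq_bigr => j _; rewrite uE.
(* At the node [x i] only the term [j = i] survives, leaving [f (x i)]. *)
move=> i; rewrite kernel_comb_sum (bigD1 i)//= uE ux eqxx mulr1.
rewrite big1 ?addr0// => j ji.
by rewrite uE ux eq_sym (negbTE ji) mulr0.
Qed.

End Kernel.

Theorem proposition3 (R : realType) (d : nat) (Omega : set 'rV[R]_d)
  (K : Omega -> Omega -> R) (N : nat) (x : 'I_N -> Omega)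
  (u : 'I_N -> Omega -> R) :
  strictly_posdef K ->
  injective x ->
  (forall y : Omega, interpolant K x (fun=> 1) y != 0) ->
  cardinal_basis K x u ->
  (forall y : Omega, \sum_(k < N) u k y != 0) /\
  shepard_method x (fun j y => u j y / \sum_(k < N) u k y)
    (rescaled_interpolant K x).
Proof.
move=> Kpos xinj Pg_neq0 ucard.
have PgE y : interpolant K x (fun=> 1) y = \sum_(k < N) u k y.
  rewrite (interpolant_cardinal _ _ Kpos xinj _ _ _ ucard).
  by under eq_bigr do rewrite mul1r.
(* This justifies the cancellation that makes the weights sum to 1. *)
have sum_neq0 y : \sum_(k < N) u k y != 0 by rewrite -PgE.
split=> //; split=> [y|f y]; first by rewrite -mulr_suml divff.
rewrite /rescaled_interpolant PgE.
rewrite (interpolant_cardinal _ _ Kpos xinj _ _ _ ucard) mulr_suml.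
by under eq_bigr do rewrite -mulrA.
Qed.
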